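(* Let $f(X)=a_{0}+a_{1}X+\cdots +a_{n}X^{n}\in \mathbb{Z}[X]$, $a_{0}a_{n}\neq 0$. Suppose there exist an index $j\in \{2,\dots ,n-2\}$ and two distinct prime numbers $p$ and $q$ such that (i) $\nu _{p}(a_{1})=\nu _{q}(a_{j})=0$ and $\nu _{p}(a_{n})\nu _{q}(a_{0})\nu _{q}(a_{n})\neq 0$; (ii) $\frac{\nu _{p}(a_{i})}{i-1}>\frac{\nu _{p}(a_{n})}{n-1}$ for $i=2,\dots ,n-1$; (iii) $\frac{\nu _{q}(a_{i})}{j-i}>\frac{\nu _{q}(a_{0})}{j}$ for $i=1,\dots ,j-1$, and $\frac{\nu _{q}(a_{i})}{i-j}>\frac{\nu _{q}(a_{n})}{n-j}$ for $i=j+1,\dots ,n-1$; (iv) $\gcd(\nu _{p}(a_{n}),n-1)=\gcd(\nu _{q}(a_{0}),j)=\gcd(\nu _{q}(a_{n}),n-j)=1$. Then $f$ is irreducible over $\mathbb{Q}$.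
   Context: For a prime $p$ and a nonzero integer $m$, $\nu_p(m)$ is the largest integer $i$ such that $p^i\mid m$; by convention $\nu_p(0)=\infty$ (so lower bounds on $\nu_p(a_i)$ hold automatically when $a_i=0$). *)

(* Defs.v *)
(* MathComp, with the extended numbers of MathComp-Analysis over [rat]. *)
From mathcomp Require Import all_boot all_order all_algebra.
From mathcomp Require Import constructive_ereal.

Set Implicit Arguments.
Unset Strict Implicit.
Unset Printing Implicit Defensive.

Import Order.TTheory GRing.Theory Num.Theory.

Local Open Scope ring_scope.

(* For p prime and m != 0, the largest i such that p ^ i divides m;
   meaningless for m = 0, where [logn] returns 0. *)
Definition vnat (p : nat) (m : int) : nat := logn p `|m|%N.

Definition nu (p : nat) (m : int) : \bar rat :=
  if m == 0 then +oo%E else (vnat p m)%:R%:E.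

(* Main.v *)
(* The p-adic Newton polygon of a product is the Minkowski sum of those of the
   factors (Dumas), and a face without interior lattice points must come
   entirely from one factor. The p-adic polygon of [f] has such a face over
   [1, n], so in a factorization over the integers one factor is linear. The
   q-adic polygon consists of such faces over [0, j] and [j, n], both of width
   at least 2, so that no linear factor fits. *)
Require Import Defs.
From mathcomp Require Import all_boot all_order all_algebra.
From mathcomp Require Import constructive_ereal.
From mathcomp Require Import zify ring.

Set Implicit Arguments.
Unset Strict Implicit.
Unset Printing Implicit Defensive.

Import Order.TTheory GRing.Theory Num.Theory.
Local Open Scope ring_scope.

(** * Valuations of products and sums *)

Lemma dvdz_pfactor (p : nat) (hp : prime p) (e : nat) (x : int) :
  x != 0 -> ((p ^ e)%N%:Z %| x)%Z = (e <= vnat p x)%N.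
Proof. by move=> x0; rewrite dvdzE /= pfactor_dvdn // lt0n absz_eq0. Qed.

Lemma vnatM (p : nat) (x y : int) :
  x != 0 -> y != 0 -> vnat p (x * y) = (vnat p x + vnat p y)%N.
Proof. by move=> x0 y0; rewrite /vnat abszM lognM // lt0n absz_eq0. Qed.

(** Otherwise a power of [p] one higher than the one in the sum would divide every term, and so the
    sum. *)
Lemma vnat_sum_ge (p : nat) (hp : prime p) (I : finType) (P : pred I)
    (F : I -> int) :
  \sum_(i | P i) F i != 0 ->
  exists i,
    [/\ P i, F i != 0 & (vnat p (F i) <= vnat p (\sum_(i | P i) F i))%N].
Proof.
set S := \sum_(i | P i) F i => S0.
have [/existsP[i /and3P[]]|/existsPn noF] :=
  boolP [exists i, [&& P i, F i != 0 & (vnat p (F i) <= vnat p S)%N]].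
  by exists i.
suff : ((p ^ (vnat p S).+1)%N%:Z %| S)%Z by rewrite dvdz_pfactor // ltnn.
apply: rpred_sum => i Pi; have := noF i; rewrite Pi /=.
have [->|Fi0] := eqVneq (F i) 0; first by rewrite rpred0.
by rewrite -ltnNge -dvdz_pfactor.
Qed.

(** The guard on [y] makes 0 behave as if its valuation were infinite, although [vnat] sends it to
    0. *)
Lemma vnatD (p : nat) (hp : prime p) (x y : int) :
  x != 0 -> (y != 0 -> (vnat p x < vnat p y)%N) ->
  x + y != 0 /\ vnat p (x + y) = vnat p x.
Proof.
move=> x0; have [->|y0 /(_ isT) lt_xy] := eqVneq y 0; first by rewrite addr0.
have dy : ((p ^ (vnat p x).+1)%N%:Z %| y)%Z by rewrite dvdz_pfactor.
have nxy : ~~ ((p ^ (vnat p x).+1)%N%:Z %| x + y)%Z.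
  by rewrite rpredDr // dvdz_pfactor // ltnn.
have xy0 : x + y != 0 by apply: contraNneq nxy => ->; exact: rpred0.
split=> //; apply/eqP; rewrite eqn_leq; apply/andP; split.
  by rewrite leqNgt -dvdz_pfactor.
rewrite -dvdz_pfactor //; apply: rpredD; rewrite dvdz_pfactor //.
exact: ltnW.
Qed.

(** * Faces of the Newton polygon *)

(** For [A > 0] this is [A] times the height at which the line of slope [- B / A] through the point
    of index [i] meets the vertical axis. The scaling keeps it an integer; it is meaningful only for
    nonzero coefficients. *)
Definition weight (p A : nat) (B : int) (g : {poly int}) (i : nat) : int :=
  A%:Z * (vnat p g`_i)%:Z + B * i%:Z.

(* The face of slope [- B / A] of the p-adic Newton polygon of [g] lies over
   the interval [s, t]; it is a vertex when [s = t]. *)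
Record face (p A : nat) (B : int) (g : {poly int}) (s t : nat) : Prop := Face {
  face_l : g`_s != 0;
  face_r : g`_t != 0;
  face_eq : weight p A B g s = weight p A B g t;
  face_min : forall i, g`_i != 0 -> weight p A B g s <= weight p A B g i;
  face_strict : forall i, g`_i != 0 -> (i < s)%N || (t < i)%N ->
    weight p A B g s < weight p A B g i }.

Lemma face_uniq p A B g s t s' t' :
  face p A B g s t -> face p A B g s' t' -> s = s' /\ t = t'.
Proof.
move=> [s0 t0 e m lt] [s0' t0' e' m' lt'].
(* Both left ends minimise the weight; strictness then puts each interval inside the other. *)
have w : weight p A B g s = weight p A B g s'.
  by apply/eqP; rewrite eq_le m // m'.
have := lt _ s0'; have := lt _ t0'; have := lt' _ s0; have := lt' _ t0.
rewrite -e -e' w ltxx; lia.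
Qed.

Lemma neq0_coef_size (h : {poly int}) i : h`_i != 0 -> (i < size h)%N.
Proof. by rewrite ltnNge; apply: contraNN => /leq_sizeP->. Qed.

Lemma face_exists p A B g : g != 0 -> exists s t, face p A B g s t.
Proof.
move=> g0; have sg : (size g).-1 \in gtn (size g).
  by rewrite inE ltn_predL lt0n size_poly_eq0.
have lg0 : g`_(Ordinal sg) != 0 by rewrite -lead_coefE lead_coef_eq0.
pose W i := weight p A B g i.
have [m gm0 mmin] := @arg_minP _ _ 'I_(size g) (Ordinal sg)
  (fun i => g`_i != 0) (fun i => W i) lg0.
have min i : g`_i != 0 -> W m <= W i.
  by move=> gi0; exact: (mmin (Ordinal (neq0_coef_size gi0))).
pose P i := (g`_i != 0) && (W i == W m).
have exP : exists i, P i by exists m; rewrite /P gm0 eqxx.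
have leP i : P i -> (i <= size g)%N.
  by move=> /andP[/neq0_coef_size/ltnW].
(* The face runs from the least to the greatest minimiser of the weight. *)
have [s /andP[s0 /eqP es] smin] := ex_minnP exP.
have [t /andP[t0 /eqP et] tmax] := ex_maxnP exP leP.
exists s, t; split=> //; rewrite -/(W s) es.
- by rewrite -et.
- exact: min.
move=> i gi0 out; rewrite lt_neqAle min // andbT; apply/negP => /eqP ei.
have Pi : P i by rewrite /P gi0 ei eqxx.
by have := smin i Pi; have := tmax i Pi; lia.
Qed.

(** * Newton polygons of products *)

(** One term of the convolution sum has strictly the smallest valuation, so it cannot be
    cancelled. *)
Lemma vnat_coefM (p : nat) (hp : prime p) (g h : {poly int}) (s s' : nat) :
  g`_s != 0 -> h`_s' != 0 ->
  (forall i i', (i + i' = s + s')%N -> i != s -> g`_i != 0 -> h`_i' != 0 ->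
     (vnat p g`_s + vnat p h`_s' < vnat p g`_i + vnat p h`_i')%N) ->
  (g * h)`_(s + s') != 0 /\
  vnat p (g * h)`_(s + s') = (vnat p g`_s + vnat p h`_s')%N.
Proof.
move=> gs0 hs0 lt.
have ls : (s < (s + s').+1)%N by lia.
rewrite coefM (bigD1 (Ordinal ls)) //= addKn -vnatM //.
apply: vnatD => //; first by rewrite mulf_neq0.
move/(vnat_sum_ge hp) => [i [ne]]; rewrite mulf_eq0 negb_or => /andP[gi0 hi0].
apply: leq_trans; rewrite !vnatM //; apply: lt => //.
by have := ltn_ord i; lia.
Qed.

(** Weights add over pairs of indices. Any other pair with sum [s + s'] has a member left of its
    face, hence a larger total weight; symmetrically at [t + t']. *)
Lemma faceM p (hp : prime p) A B g h s t s' t' : (0 < A)%N ->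
  face p A B g s t -> face p A B h s' t' ->
  face p A B (g * h) (s + s') (t + t').
Proof.
move=> A0 [s0 t0 e m lt] [s0' t0' e' m' lt'].
have Wadd i i' : A%:Z * (vnat p g`_i + vnat p h`_i')%N%:Z + B * (i + i')%N%:Z =
    weight p A B g i + weight p A B h i'.
  by rewrite /weight; lia.
have wlt i i' k k' : (i + i' = k + k')%N ->
    weight p A B g i + weight p A B h i' <
      weight p A B g k + weight p A B h k' ->
    (vnat p g`_i + vnat p h`_i' < vnat p g`_k + vnat p h`_k')%N.
  by move=> eik; rewrite -!Wadd eik ltrD2r ltr_pM2l // ltz_nat.
have [gs0 vs] : (g * h)`_(s + s') != 0 /\
    vnat p (g * h)`_(s + s') = (vnat p g`_s + vnat p h`_s')%N.
  apply: vnat_coefM => // i i' eii ne gi0 hi0; apply: wlt => //.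
  have := m _ gi0; have := m' _ hi0; have := lt _ gi0; have := lt' _ hi0; lia.
have [gt0 vt] : (g * h)`_(t + t') != 0 /\
    vnat p (g * h)`_(t + t') = (vnat p g`_t + vnat p h`_t')%N.
  apply: vnat_coefM => // i i' eii ne gi0 hi0; apply: wlt => //.
  rewrite -e -e'.
  have := m _ gi0; have := m' _ hi0; have := lt _ gi0; have := lt' _ hi0; lia.
have ws : weight p A B (g * h) (s + s') = weight p A B g s + weight p A B h s'.
  by rewrite -Wadd -vs.
have wt : weight p A B (g * h) (t + t') = weight p A B g s + weight p A B h s'.
  by rewrite e e' -Wadd -vt.
(* A nonzero coefficient of the product weighs at least as much as one of the pairs that contribute
   to it. *)
have low i : (g * h)`_i != 0 -> exists k k', [/\ (k + k' = i)%N,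
    g`_k != 0, h`_k' != 0 &
    weight p A B g k + weight p A B h k' <= weight p A B (g * h) i].
  rewrite coefM => /[dup] + /(vnat_sum_ge hp)[k [_]]; rewrite -coefM => gh0.
  rewrite mulf_eq0 negb_or => /andP[gk0 hk0]; rewrite vnatM // => le.
  have ki : (k + (i - k) = i)%N by have := ltn_ord k; lia.
  exists k, (i - k)%N; split=> //.
  by rewrite -Wadd ki lerD2r ler_pM2l // lez_nat coefM.
split=> //; rewrite ?ws ?wt // => i /low[k [k' [<- gk0 hk0]]].
all: have := m _ gk0; have := m' _ hk0.
all: have := lt _ gk0; have := lt' _ hk0; lia.
Qed.

(* The lattice points of a face of a factor have [A] dividing their horizontal
   distance, so a face without interior lattice points cannot be shared. *)
Lemma primitive_faceM p (hp : prime p) A B g h s t :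
  (0 < A)%N -> t = (s + A)%N -> coprimez A%:Z B -> face p A B (g * h) s t ->
  exists s1 t1 s2 t2, [/\ face p A B g s1 t1, face p A B h s2 t2,
    (s = s1 + s2)%N, (t = t1 + t2)%N & t1 = s1 \/ t2 = s2].
Proof.
move=> A0 et cAB fgh.
have [g0 h0] : g != 0 /\ h != 0.
  apply/andP; rewrite -negb_or -mulf_eq0.
  by apply: contraNneq (face_l fgh) => ->; rewrite coef0.
have [s1 [t1 f1]] := face_exists p A B g0.
have [s2 [t2 f2]] := face_exists p A B h0.
have [es et'] := face_uniq fgh (faceM hp A0 f1 f2).
exists s1, t1, s2, t2; split=> //.
have width k s0 t0 : face p A B k s0 t0 -> (s0 <= t0)%N /\ (A %| t0 - s0)%N.
  move=> f; have le : (s0 <= t0)%N.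
    rewrite leqNgt; apply/negP=> lt.
    by have := face_strict f (face_l f); rewrite lt orbT ltxx => /(_ isT).
  (* Equal weights at the two ends make [B * (t0 - s0)] a multiple of [A], and [B] is prime to
     [A]. *)
  split=> //; have : (A%:Z %| B * (t0 - s0)%N%:Z)%Z.
    apply/dvdzP; exists ((vnat p k`_s0)%:Z - (vnat p k`_t0)%:Z).
    by rewrite -subzn // mulrBr; have := face_eq f; rewrite /weight; lia.
  by rewrite Gauss_dvdzr.
have [le1 /dvdnP[c1 e1]] := width _ _ _ f1.
have [le2 /dvdnP[c2 e2]] := width _ _ _ f2.
(* Two multiples of [A] with sum [A]: one of the widths is 0. *)
have /eqP : ((c1 + c2) * A = 1 * A)%N by rewrite mulnDl; lia.
rewrite eqn_pmul2r // addn_eq1 => /orP[] /andP[/eqP c1E /eqP c2E].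
  by right; rewrite c2E in e2; lia.
by left; rewrite c1E in e1; lia.
Qed.

(* Convexity of the Newton polygon: as the slope of a face is [- B / A], the
   face of negative slope lies to the left of the one of positive slope. *)
Lemma face_mono p A B A' B' h s t s' t' :
  (0 < A)%N -> (0 < A')%N -> B' < 0 -> 0 < B ->
  face p A B h s t -> face p A' B' h s' t' -> (t <= s')%N.
Proof.
move=> A0 A0' B0' B0 f f'; rewrite leqNgt; apply/negP => lt.
have := face_min f (face_l f'); have := face_min f' (face_r f).
rewrite (face_eq f) /weight.
have : B * s'%:Z < B * t%:Z by rewrite ltr_pM2l // ltz_nat.
have : B' * t%:Z < B' * s'%:Z by rewrite ltr_nM2l // ltz_nat.
(* With [s' < t], minimality on the first face makes the valuation at [t] smaller than at [s'], and
   minimality on the second makes it larger. *)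
case: (leqP (vnat p h`_s') (vnat p h`_t)) => [le|/ltnW le].
  have : A%:Z * (vnat p h`_s')%:Z <= A%:Z * (vnat p h`_t)%:Z.
    by rewrite ler_pM2l // lez_nat.
  lia.
have : A'%:Z * (vnat p h`_t)%:Z <= A'%:Z * (vnat p h`_s')%:Z.
  by rewrite ler_pM2l // lez_nat.
lia.
Qed.

(** * Faces obtained from conditions on the coefficients *)

(** The face lies on the line from [(s, 0)] rising to the last point. Left of [s] that line is below
    the axis, and right of [t] there are no points. *)
Lemma ascending_face p (f : {poly int}) s t :
  (s < t)%N -> size f = t.+1 -> f`_s != 0 -> vnat p f`_s = 0%N ->
  (0 < vnat p f`_t)%N ->
  (forall i, (s < i < t)%N -> f`_i != 0 ->
     (vnat p f`_t * (i - s) < vnat p f`_i * (t - s))%N) ->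
  face p (t - s) (- (vnat p f`_t)%:Z) f s t.
Proof.
move=> lt_st sf fs0 vs V0 mid.
have ft0 : f`_t != 0.
  by have := lead_coef_eq0 f; rewrite lead_coefE -size_poly_eq0 sf /= => ->.
have le i : f`_i != 0 -> (i <= t)%N.
  by move/neq0_coef_size; rewrite sf.
have W i : (s <= i)%N ->
    weight p (t - s) (- (vnat p f`_t)%:Z) f i - - (vnat p f`_t)%:Z * s%:Z =
    (vnat p f`_i * (t - s))%N%:Z - (vnat p f`_t * (i - s))%N%:Z.
  by move=> si; rewrite /weight !PoszM -(subzn si) -(subzn (ltnW lt_st)); ring.
have Ws : weight p (t - s) (- (vnat p f`_t)%:Z) f s = - (vnat p f`_t)%:Z * s%:Z.
  by rewrite /weight vs mulr0 add0r.
have low i : (i < s)%N -> weight p (t - s) (- (vnat p f`_t)%:Z) f s <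
    weight p (t - s) (- (vnat p f`_t)%:Z) f i.
  move=> lt_is; rewrite Ws /weight.
  have : (vnat p f`_t)%:Z * i%:Z < (vnat p f`_t)%:Z * s%:Z.
    by rewrite ltr_pM2l // ltz_nat.
  have : 0 <= (t - s)%N%:Z * (vnat p f`_i)%:Z by [].
  lia.
split=> // [|i fi0|i fi0 /orP[]]; first by have := W t (ltnW lt_st); lia.
- have [/low/ltW//|si] := ltnP i s.
  have [->|ne_it] := eqVneq i t; first by have := W t (ltnW lt_st); lia.
  have [->//|ne_is] := eqVneq i s.
  have := W i si; have := mid i _ fi0; have := le _ fi0; lia.
- exact: low.
by rewrite ltnNge le.
Qed.

(** The line falls to the axis at [t], so every point beyond [t] lies strictly above it. *)
Lemma descending_face p (f : {poly int}) t :
  f`_0 != 0 -> f`_t != 0 -> vnat p f`_t = 0%N ->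
  (0 < vnat p f`_0)%N ->
  (forall i, (0 < i < t)%N -> f`_i != 0 ->
     (vnat p f`_0 * (t - i) < vnat p f`_i * t)%N) ->
  face p t (vnat p f`_0)%:Z f 0 t.
Proof.
move=> f0 ft0 vt V0 mid.
have W0 : weight p t (vnat p f`_0)%:Z f 0 = (vnat p f`_0 * t)%N%:Z.
  by rewrite /weight mulr0 addr0 PoszM mulrC.
have high i : (t < i)%N ->
    weight p t (vnat p f`_0)%:Z f 0 < weight p t (vnat p f`_0)%:Z f i.
  by move=> ti; rewrite W0 /weight PoszM ltr_wpDl // ltr_pM2l // ltz_nat.
split=> // [|i fi0|i fi0 /orP[//|]].
- by rewrite W0 /weight vt mulr0 add0r PoszM.
- have [/high/ltW//|it] := ltnP t i.
  have [->//|i0] := posnP i.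
  have [->|ne_it] := eqVneq i t.
    by rewrite W0 /weight vt mulr0 add0r PoszM.
  have := mid i _ fi0; rewrite mulnBr W0 /weight; lia.
exact: high.
Qed.

Lemma nu_div_lt (p : nat) (x y : int) (k l : nat) :
  x != 0 -> y != 0 -> (0 < k)%N -> (0 < l)%N ->
  (nu p x / k%:R%:E < nu p y / l%:R%:E)%E ->
  (vnat p x * l < vnat p y * k)%N.
Proof.
move=> x0 y0 k0 l0; rewrite /nu (negPf x0) (negPf y0) !inver.
rewrite !pnatr_eq0 (gtn_eqF k0) (gtn_eqF l0) -!EFinM lte_fin.
by rewrite ltr_pdivrMr ?ltr0n // mulrAC ltr_pdivlMr ?ltr0n // -!natrM ltr_nat.
Qed.

Lemma nu_neq0 (p : nat) (x : int) : nu p x != 0%E -> x != 0 -> (0 < vnat p x)%N.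
Proof.
by rewrite /nu => + /negPf x0; rewrite x0 eqe pnatr_eq0 lt0n.
Qed.

Lemma nu_eq0 (p : nat) (x : int) : nu p x = 0%E -> x != 0 /\ vnat p x = 0%N.
Proof.
rewrite /nu; case: eqVneq => // _ /eqP; rewrite eqe pnatr_eq0.
by move/eqP.
Qed.

(* A factor [g] of degree 1 is too narrow for both faces, so it meets each of
   them in a vertex; the first is at 0 and the second at 1, which leaves the
   cofactor with a face ending at [j] for the small slope and one starting at
   [j - 1] for the large slope. *)
Lemma no_linear_factor q (hq : prime q) (g h : {poly int}) (j n U V : nat) :
  (1 < j)%N -> (j + 1 < n)%N -> size g = 2%N ->
  (0 < U)%N -> (0 < V)%N -> coprime U j -> coprime V (n - j) ->
  size (g * h) = n.+1 ->
  face q j U%:Z (g * h) 0 j ->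
  ~ face q (n - j) (- V%:Z) (g * h) j n.
Proof.
move=> j1 jn sg U0 V0 cU cV sgh F1 F2.
have h0 : h != 0 by apply: contra_eq_neq sgh => ->; rewrite mulr0 size_poly0.
have g0 : g != 0 by rewrite -size_poly_eq0 sg.
have sh : size h = n by move: sgh; rewrite size_mul // sg => -[].
have [s1 [t1 [s2 [t2 [f1 f2 e1 e1' d1]]]]] : exists s1 t1 s2 t2,
    [/\ face q j U%:Z g s1 t1, face q j U%:Z h s2 t2,
    (0 = s1 + s2)%N, (j = t1 + t2)%N & t1 = s1 \/ t2 = s2].
  apply: (primitive_faceM hq _ _ _ F1); try lia.
  by rewrite coprimezE /= coprime_sym.
have [s3 [t3 [s4 [t4 [f3 f4 e2 e2' d2]]]]] : exists s1 t1 s2 t2,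
    [/\ face q (n - j) (- V%:Z) g s1 t1, face q (n - j) (- V%:Z) h s2 t2,
    (j = s1 + s2)%N, (n = t1 + t2)%N & t1 = s1 \/ t2 = s2].
  apply: (primitive_faceM hq _ _ _ F2); try lia.
  by rewrite coprimezN coprimezE /= coprime_sym.
have := neq0_coef_size (face_r f1); have := neq0_coef_size (face_r f2).
have := neq0_coef_size (face_r f3); have := neq0_coef_size (face_r f4).
rewrite sg sh => b4 b3 b2 b1.
have : (t2 <= s4)%N.
  by apply: (face_mono _ _ _ _ f2 f4); lia.
(* The sizes force [t1 = 0] and [t2 = j], then [t3 = s3 = 1] and [s4 = j - 1], against
   [t2 <= s4]. *)
lia.
Qed.

(** * The irreducibility criterion *)

Unset Implicit Arguments.

Theorem theorem1p28 (n : nat) (a : nat -> int)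
  (ha : a 0%N * a n != 0)
  (j : nat) (hj : (2 <= j <= n - 2)%N)
  (p q : nat) (hp : prime p) (hq : prime q) (hpq : p != q)
  (hi0 : nu p (a 1%N) = 0%E /\ nu q (a j) = 0%E)
  (hi1 : (nu p (a n) * nu q (a 0%N) * nu q (a n) != 0)%E)
  (hii : forall i : nat, (2 <= i <= n - 1)%N ->
     (nu p (a i) / (i%:R - 1)%R%:E > nu p (a n) / (n%:R - 1)%R%:E)%E)
  (hiii0 : forall i : nat, (1 <= i <= j - 1)%N ->
     (nu q (a i) / (j%:R - i%:R)%R%:E > nu q (a 0%N) / (j%:R)%R%:E)%E)
  (hiii1 : forall i : nat, (j + 1 <= i <= n - 1)%N ->
     (nu q (a i) / (i%:R - j%:R)%R%:E > nu q (a n) / (n%:R - j%:R)%R%:E)%E)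
  (hiv : [/\ gcdn (vnat p (a n)) (n - 1) = 1%N,
             gcdn (vnat q (a 0%N)) j = 1%N &
             gcdn (vnat q (a n)) (n - j) = 1%N]) :
  irreducible_poly
    (map_poly (intr : int -> rat) (\poly_(i < n.+1) a i)).
Proof.
have [a0 an] : a 0%N != 0 /\ a n != 0.
  by apply/andP; rewrite -negb_or -mulf_eq0.
have [/nu_eq0[a1 v1] /nu_eq0[aj vj]] := hi0.
have [c1 c2 c3] := hiv.
move: hi1; rewrite !mule_eq0 !negb_or -andbA => /and3P[].
move=> /nu_neq0/(_ an) vpn /nu_neq0/(_ a0) vq0 /nu_neq0/(_ an) vqn.
have {}hii i : (1 < i < n)%N -> a i != 0 ->
    (vnat p (a n) * (i - 1) < vnat p (a i) * (n - 1))%N.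
  move=> hi ai; have := hii i ltac:(lia).
  rewrite -[1%R]/(1%:R) -!natrB; try lia.
  by apply: nu_div_lt => //; lia.
have {}hiii0 i : (0 < i < j)%N -> a i != 0 ->
    (vnat q (a 0%N) * (j - i) < vnat q (a i) * j)%N.
  move=> hi ai; have := hiii0 i ltac:(lia); rewrite -!natrB; try lia.
  by apply: nu_div_lt => //; lia.
have {}hiii1 i : (j < i < n)%N -> a i != 0 ->
    (vnat q (a n) * (i - j) < vnat q (a i) * (n - j))%N.
  move=> hi ai; have := hiii1 i ltac:(lia); rewrite -!natrB; try lia.
  by apply: nu_div_lt => //; lia.
set f := \poly_(i < n.+1) a i.
have fE i : (i <= n)%N -> f`_i = a i by move=> le; rewrite coef_poly ltnS le.
have sf : size f = n.+1 by apply: size_poly_eq.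
have Fp : face p (n - 1) (- (vnat p f`_n)%:Z) f 1 n.
  apply: ascending_face; rewrite ?fE //; try lia.
  by move=> i hi; rewrite fE; [exact: hii|]; lia.
have Fq1 : face q j (vnat q f`_0)%:Z f 0 j.
  apply: descending_face; rewrite ?fE //; try lia.
  by move=> i hi; rewrite fE; [exact: hiii0|]; lia.
have Fq2 : face q (n - j) (- (vnat q f`_n)%:Z) f j n.
  apply: ascending_face; rewrite ?fE //; try lia.
  by move=> i hi; rewrite fE; [exact: hiii1|]; lia.
rewrite !fE // in Fp Fq1 Fq2.
have not2 g h : f = g * h -> size g != 2%N.
  move=> fgh; apply/eqP => sg.
  rewrite fgh in sf Fq1 Fq2.
  by apply: (no_linear_factor hq _ _ sg vq0 vqn _ _ sf Fq1 Fq2);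
    rewrite /coprime ?c2 ?c3 //; lia.
split=> [|d d1 df]; first by rewrite size_rat_int_poly sf; lia.
(* By Gauss's lemma the rational divisor [d] is a scalar multiple of an integer factor [g] of
   [f]. *)
rewrite -dvdp_size_eqp //; move: df => /dvdpP_rat_int[g [c c0 dE] [h fgh]].
rewrite dE size_scale // !size_rat_int_poly in d1 *.
have [g0 h0] : g != 0 /\ h != 0.
  by apply/andP; rewrite -negb_or -mulf_eq0 -fgh -size_poly_eq0 sf.
have sgh : (size g + size h)%N = n.+2.
  move: sf; rewrite fgh size_mul //; move: g0; rewrite -size_poly_gt0.
  by case: (size g) => // k _; rewrite !addSn /= => ->.
have g_n2 := not2 _ _ fgh; have h_n2 := not2 h g (etrans fgh (mulrC g h)).
have [s1 [t1 [s2 [t2 [f1 f2 e1 e2 d12]]]]] : exists s1 t1 s2 t2,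
    [/\ face p (n - 1) (- (vnat p (a n))%:Z) g s1 t1,
        face p (n - 1) (- (vnat p (a n))%:Z) h s2 t2,
        (1 = s1 + s2)%N, (n = t1 + t2)%N & t1 = s1 \/ t2 = s2].
  rewrite fgh in Fp; apply: (primitive_faceM hp _ _ _ Fp); try lia.
  by rewrite coprimezN coprimezE /= coprime_sym /coprime c1.
have lt1 := neq0_coef_size (face_r f1); have lt2 := neq0_coef_size (face_r f2).
rewrite sf; rewrite -!size_poly_gt0 in g0 h0.
(* The factor carrying the long face has degree at least [n - 1], so the other has degree at most 1,
   and degree 1 is excluded. As [g] is not constant, [h] is. *)
move: (size g) (size h) d1 g_n2 h_n2 lt1 lt2 g0 h0 sgh => m1 m2.
by clear -hj e1 e2 d12; lia.
Qed.
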